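(* Let $X$ be a complex Banach space, let $A, B \in B(X)$, and suppose that the spectrum $\sigma(A)$ is $2\pi i$-congruence free. Then $e^A B = B e^A$ if and only if $AB = BA$.
   Context: $B(X)$ denotes the Banach algebra of all bounded linear operators $X \to X$ on the Banach space $X$; $\sigma(A) \subset \mathbb{C}$ is the spectrum of $A$ in $B(X)$, and $e^A = \sum_{n\ge 0} A^n/n!$. For $z \in \mathbb{C}$, a set $S \subset \mathbb{C}$ is called $z$-congruence free if for all $s_1, s_2 \in S$ and all $k \in \mathbb{Z}\setminus\{0\}$ one has $s_1 - s_2 \neq kz$. *)

(* Defs.v *)
From HB Require Import structures.
From mathcomp Require Import all_boot all_order all_algebra.
From mathcomp Require Import complex.
From mathcomp Require Import all_classical all_reals all_analysis.

Set Implicit Arguments.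
Unset Strict Implicit.
Unset Printing Implicit Defensive.

Import Order.TTheory GRing.Theory Num.Theory.
Import numFieldNormedType.Exports.

Local Open Scope classical_set_scope.
Local Open Scope ring_scope.
Local Open Scope complex_scope.

Section BoundedOperators.
Context {R : realType} (X : normedModType R[i]).

Definition bounded_linear : {pred (X -> X)} :=
  [pred f : X -> X | `[< linear f /\
     exists M : R, forall x, `|f x| <= M%:C * `|x| >]].

Lemma bounded_linearP (f : X -> X) :
  reflect (linear f /\ exists M : R, forall x, `|f x| <= M%:C * `|x|)
          (f \in bounded_linear).
Proof. by rewrite inE; exact: asboolP. Qed.

Record bop := Bop { bop_fun :> X -> X; bop_prop : bop_fun \in bounded_linear }.

HB.instance Definition _ := [isSub for bop_fun].
HB.instance Definition _ := [Choice of bop by <:].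

Lemma bounded_linear_submod_closed : submod_closed bounded_linear.
Proof.
split.
  apply/bounded_linearP; split; first by move=> a x y; rewrite scaler0 addr0.
  by exists 0 => x; rewrite normr0 mul0r.
move=> a f g /bounded_linearP[lf [Mf fM]] /bounded_linearP[lg [Mg gM]].
apply/bounded_linearP; split.
  move=> b x y; rewrite !fctE lf lg !scalerDr !scalerA (mulrC a b).
  by rewrite addrACA.
have Ra : `|a| = (complex.Re `|a|)%:C by rewrite RRe_real// normr_real.
exists (complex.Re `|a| * Mf + Mg) => x; rewrite !fctE.
rewrite (le_trans (ler_normD _ _))// rmorphD rmorphM/= -Ra mulrDl lerD//.
by rewrite normrZ -mulrA ler_wpM2l.
Qed.

HB.instance Definition _ := GRing.isSubmodClosed.Build _ _ bounded_linear
  bounded_linear_submod_closed.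
HB.instance Definition _ := [SubChoice_isSubLmodule of bop by <:].

Lemma bop_linear (A : bop) : linear A.
Proof. by case: (bounded_linearP _ (bop_prop A)). Qed.

HB.instance Definition _ (A : bop) :=
  GRing.isLinear.Build _ _ _ _ (bop_fun A) (@bop_linear A).

Lemma bop_bounded (A : bop) : exists M : R, forall x, `|A x| <= M%:C * `|x|.
Proof. by case: (bounded_linearP _ (bop_prop A)). Qed.

Lemma bopP (A B : bop) : (forall x, A x = B x) -> A = B.
Proof. by move=> AB; apply/val_inj/funext. Qed.

Lemma bopD (A B : bop) x : (A + B) x = A x + B x. Proof. by []. Qed.
Lemma bopN (A : bop) x : (- A) x = - A x. Proof. by []. Qed.
Lemma bopB (A B : bop) x : (A - B) x = A x - B x. Proof. by []. Qed.
Lemma bopZ a (A : bop) x : (a *: A) x = a *: A x. Proof. by []. Qed.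
Lemma bop0 x : (0 : bop) x = 0. Proof. by []. Qed.

Lemma bop_one_subproof : (id : X -> X) \in bounded_linear.
Proof.
apply/bounded_linearP; split; first by [].
by exists 1 => x; rewrite rmorph1 mul1r.
Qed.
Definition bop_one := Bop bop_one_subproof.

Lemma bop_mul_subproof (A B : bop) : (A \o B : X -> X) \in bounded_linear.
Proof.
apply/bounded_linearP; split; first by move=> a x y /=; rewrite !linearP.
have [MA AM] := bop_bounded A; have [MB BM] := bop_bounded B.
exists (Num.max MA 0 * MB) => x /=; rewrite (le_trans (AM _))//.
rewrite (@le_trans _ _ ((Num.max MA 0)%:C * `|B x|))//.
  by rewrite ler_wpM2r// lecR le_max lexx.
by rewrite rmorphM -mulrA ler_wpM2l// ler0c le_max lexx orbT.
Qed.
Definition bop_mul (A B : bop) := Bop (bop_mul_subproof A B).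

Let mulA : associative bop_mul. Proof. by move=> A B C; exact: bopP. Qed.
Let mul1 : left_id bop_one bop_mul. Proof. by move=> A; exact: bopP. Qed.
Let mulr1 : right_id bop_one bop_mul. Proof. by move=> A; exact: bopP. Qed.
Let mulDl : left_distributive bop_mul +%R.
Proof. by move=> A B C; exact: bopP. Qed.
Let mulDr : right_distributive bop_mul +%R.
Proof. by move=> A B C; apply: bopP => x; exact: (linearD A (B x) (C x)). Qed.

(* A ring with possibly 1 = 0, because X may be the zero space. *)
HB.instance Definition _ :=
  GRing.Zmodule_isPzRing.Build bop mulA mul1 mulr1 mulDl mulDr.

Lemma bop1 x : (1 : bop) x = x. Proof. by []. Qed.
Lemma bopM (A B : bop) x : (A * B) x = A (B x). Proof. by []. Qed.

(* The norm of a normedModType over R[i] takes nonnegative real values in R[i];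
   the supremum is taken in R. *)
Definition opnorm (A : bop) : R :=
  sup [set complex.Re `|A x| | x in [set x : X | `|x| <= 1]].

Lemma Re_normE (V : normedModType R[i]) (x : V) :
  `|x| = (complex.Re `|x|)%:C.
Proof. by rewrite RRe_real// normr_real. Qed.

Let has_sup_opnorm (A : bop) :
  has_sup [set complex.Re `|A x| | x in [set x : X | `|x| <= 1]].
Proof.
split; first by exists (complex.Re `|A 0|), 0 => //=; rewrite normr0.
have [M AM] := bop_bounded A; exists (Num.max M 0) => _ [x /= x1 <-].
rewrite -lecR -Re_normE (le_trans (AM _))//.
rewrite (@le_trans _ _ ((Num.max M 0)%:C * `|x|))//.
  by rewrite ler_wpM2r// lecR le_max lexx.
by rewrite ler_piMr// ler0c le_max lexx orbT.
Qed.

Lemma opnorm_ge0 A : 0 <= opnorm A.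
Proof.
apply: (@sup_upper_bound _ _ (has_sup_opnorm A)).
by exists 0; rewrite /= ?linear0 normr0.
Qed.

Lemma opnormP (A : bop) x : `|A x| <= (opnorm A)%:C * `|x|.
Proof.
have [->|x0] := eqVneq x 0; first by rewrite linear0 !normr0 mulr0.
have nx0 : 0 < `|x| by rewrite normr_gt0.
rewrite -ler_pdivrMr// mulrC.
have -> : `|x|^-1 * `|A x| = `|A (`|x|^-1 *: x)|.
  by rewrite linearZ normrZ normfV normr_id.
rewrite Re_normE lecR.
apply: (@sup_upper_bound _ _ (has_sup_opnorm A)).
exists (`|x|^-1 *: x) => //=.
by rewrite normrZ normfV normr_id mulVf// gt_eqF.
Qed.

Lemma opnorm_le (A : bop) (M : R) : 0 <= M ->
  (forall x, `|A x| <= M%:C * `|x|) -> opnorm A <= M.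
Proof.
move=> M0 AM; apply: ge_sup; first by have [] := has_sup_opnorm A.
move=> _ [x /= x1 <-]; rewrite -lecR -Re_normE (le_trans (AM _))//.
by rewrite ler_piMr// ler0c.
Qed.

Let normD (A B : bop) : (opnorm (A + B))%:C <= (opnorm A)%:C + (opnorm B)%:C.
Proof.
rewrite -rmorphD lecR opnorm_le ?addr_ge0 ?opnorm_ge0// => x.
by rewrite rmorphD mulrDl (le_trans (ler_normD _ _))// lerD// opnormP.
Qed.

Let normZ_le (a : R[i]) (A : bop) :
  (opnorm (a *: A))%:C <= `|a| * (opnorm A)%:C.
Proof.
have Ra : `|a| = (complex.Re `|a|)%:C by rewrite RRe_real// normr_real.
have a0 : 0 <= complex.Re `|a| by rewrite -ler0c -Ra.
rewrite Ra -rmorphM lecR; apply: opnorm_le => [|x].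
  by rewrite mulr_ge0 ?opnorm_ge0.
by rewrite bopZ normrZ rmorphM/= -Ra -mulrA ler_wpM2l// opnormP.
Qed.

Let normZ (a : R[i]) (A : bop) : (opnorm (a *: A))%:C = `|a| * (opnorm A)%:C.
Proof.
apply/eqP; rewrite eq_le normZ_le/=.
have [->|a0] := eqVneq a 0; first by rewrite normr0 mul0r ler0c opnorm_ge0.
rewrite -ler_pdivlMl ?normr_gt0// -normfV.
by rewrite (le_trans _ (normZ_le _ _))// scalerA mulVf// scale1r.
Qed.

Let norm0_eq0 (A : bop) : (opnorm A)%:C = 0 -> A = 0.
Proof.
move=> A0; apply: bopP => x; apply/eqP; rewrite -normr_le0.
by rewrite (le_trans (opnormP A x))// A0 mul0r.
Qed.

HB.instance Definition _ := isPointed.Build bop 0.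
HB.instance Definition _ :=
  Lmodule_isNormed.Build R[i] bop normD normZ norm0_eq0.

Lemma bop_normE (A : bop) : `|A| = (opnorm A)%:C. Proof. by []. Qed.

Lemma bop_norm_le (A : bop) x : `|A x| <= `|A| * `|x|.
Proof. by rewrite bop_normE opnormP. Qed.

Lemma bop_normM (A B : bop) : `|A * B| <= `|A| * `|B|.
Proof.
rewrite !bop_normE -rmorphM lecR opnorm_le ?mulr_ge0 ?opnorm_ge0// => x.
by rewrite bopM (le_trans (opnormP _ _))// rmorphM -mulrA ler_wpM2l ?opnormP//
  ler0c opnorm_ge0.
Qed.

End BoundedOperators.


Section Completeness.
Context {R : realType} (X : completeNormedModType R[i]).

Lemma bop_complete (F : set_system (bop X)) :
  ProperFilter F -> cauchy F -> cvg F.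
Proof.
move=> FF Fc.
have Fc' (e : R[i]) : 0 < e -> exists A, \forall B \near F, `|A - B| < e.
  move=> e0; have /cauchyP /(_ e e0)[A FA] := Fc.
  by exists A; rewrite -ball_normE in FA.
have evl x : cvg ((fun A : bop X => A x) @ F).
  apply: cauchy_cvg; apply: cauchy_exP => e e0.
  have x1 : 0 < `|x| + 1 by rewrite ltr_wpDl.
  have [A FA] := Fc' (e / (`|x| + 1)) (divr_gt0 e0 x1).
  exists (A x); rewrite /fmapE -ball_normE.
  change (F [set B : bop X | `|A x - B x| < e]); near=> B => /=.
  rewrite -bopB (le_lt_trans (bop_norm_le _ _))//.
  rewrite (@le_lt_trans _ _ (`|A - B| * (`|x| + 1)))//.
    by rewrite ler_wpM2l// lerDl.
  by rewrite -ltr_pdivlMr//; near: B.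
pose L x : X := lim ((fun A : bop X => A x) @ F).
have close (e : R[i]) : 0 < e -> F [set A : bop X |
    forall x, `|L x - A x| <= e * `|x|].
  move=> e0; have e20 : 0 < e / 2 by rewrite divr_gt0.
  have [A0 FA0] := Fc' _ e20; near=> A => /= x; rewrite [e in leRHS]splitr mulrDl.
  rewrite (le_trans (ler_distD (A0 x) _ _))// lerD//; last first.
    rewrite -bopB (le_trans (bop_norm_le _ _))// ler_wpM2r// ltW//.
    by near: A.
  apply/ler_addgt0Pr => d d0; near F => B.
  rewrite (le_trans (ler_distD (B x) _ _))// addrC lerD//.
    rewrite distrC -bopB (le_trans (bop_norm_le _ _))// ler_wpM2r// ltW//.
    by near: B.
  by rewrite ltW//; near: B; have /cvgrPdist_lt := evl x; apply.
have LP : L \in @bounded_linear R X.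
  apply/bounded_linearP; split=> [a x y|].
    apply: (@cvg_unique _ (@norm_hausdorff _ X) _ _ _ _ (evl _)) => /=.
    rewrite (_ : (fun A => _) = (fun A : bop X => a *: A x + A y)); last first.
      by apply/funext => A; rewrite linearP.
    by apply: cvgD; [apply: cvgZl_tmp|]; exact: evl.
  near F => A.
  have LA : forall x, `|L x - A x| <= 1 * `|x| by near: A; exact: close.
  exists (1 + opnorm A) => x.
  rewrite -[L x](subrK (A x)) (le_trans (ler_normD _ _))//.
  rewrite rmorphD/= rmorph1 mulrDl lerD ?opnormP//.
apply/cvg_ex; exists (Bop LP); apply/cvgrPdist_le => e e0.
near=> A.
have eE : e = (complex.Re e)%:C by rewrite RRe_real// gtr0_real.
rewrite bop_normE eE lecR opnorm_le//; first by rewrite -lecR -eE ltW.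
move=> x; rewrite -eE bopB.
by move: x; near: A; exact: close.
Unshelve. all: by end_near. Qed.

HB.instance Definition _ := Uniform_isComplete.Build (bop X) bop_complete.

End Completeness.

Section Spectrum.
Context {R : realType}.

Definition bop_invertible (X : normedModType R[i]) (A : bop X) : Prop :=
  exists S : bop X, S * A = 1 /\ A * S = 1.

Definition bop_spectrum (X : normedModType R[i]) (A : bop X) : set R[i] :=
  [set l : R[i] | ~ bop_invertible (A - l *: (1 : bop X))].

(* The limit is taken in operator norm; it exists because bop X is complete
   whenever X is and the series is absolutely convergent. *)
Definition bop_exp (X : normedModType R[i]) (A : bop X) : bop X :=
  limn (series (fun n : nat => (n`!%:R : R[i])^-1 *: A ^+ n)).

Definition congruence_free (z : R[i]) (S : set R[i]) : Prop :=
  forall s1 s2, S s1 -> S s2 -> forall k : int, k != 0 -> s1 - s2 != k%:~R * z.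

End Spectrum.

(* Main.v *)
From HB Require Import structures.
Require Import Defs.
From mathcomp Require Import all_boot all_order all_algebra.
From mathcomp Require Import complex.
From mathcomp Require Import all_classical all_reals all_analysis.
From mathcomp Require Import zify ring lra.

(** An operator commuting with [A] commutes with the partial sums of the series
    of [e^A], hence with [e^A]. The converse is about the commutator operator
    [T : Y |-> A Y - Y A] on the Banach space of bounded operators. Left and
    right multiplication by [A] commute, so [e^T Y = e^A Y e^(-A)], and
    [e^A B = B e^A] says that [e^T B = B] ([bop_exp_commutator_fixed]). It must
    be shown that [T B = 0].

    The only obstruction to [T B = 0] is an eigenvector of [T] for some
    [2 pi i k] with [k <> 0] ([bop_exp_fixed]). To see it, take [n] large and
    put [U := e^(T/n)], so that [U^n B = B]. A discrete Fourier transform over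
    the [n]-th roots of unity decomposes [B] into vectors [Y] with
    [e^(i t) U Y = Y], where [t = 2 pi j / n] ([fixed_by_fourier]). As [n] is
    large, [T/n] is small. If [t] is near [0] modulo [2 pi], then [T/n + i t] is
    small; an operator [S] of small norm satisfies [e^S Y = Y] only if
    [S Y = 0], so [Y] is an eigenvector of [T] for a multiple of [2 pi i]. If
    [t] is far from [0], then [Y = 0], because [U] is close to [1]. When the
    multiples other than [0] are not eigenvalues, only the component [j = 0]
    survives; so [U B = B], and [T B = 0] because [T/n] is small.

    It remains to see that [T Y = l Y] forces [Y = 0] when [l = 2 pi i k] is not
    a difference of two points of the spectrum of [A]. The equation reads
    [A Y = Y (A + l)], and [A] and [A + l] have disjoint spectra; this is the
    uniqueness part of Sylvester's equation ([sylvester_inj]). On the space [K]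
    of all solutions of [A Y = Y C], left multiplication by [A] and right
    multiplication by [C] are the same operator [S]. At each [z] at least one of
    [A - z] and [C - z] is invertible, and multiplication by its inverse
    preserves [K], so [S] has empty spectrum. A bounded operator with empty
    spectrum lives on the zero space ([bop_spectrum_nonempty]), so [K = 0].

    The nonemptiness of the spectrum is obtained without complex integration, by
    Rickart's argument with means over roots of unity. *)

Set Implicit Arguments.
Unset Strict Implicit.
Unset Printing Implicit Defensive.

Import Order.TTheory GRing.Theory Num.Theory.
Import numFieldNormedType.Exports.

Local Open Scope classical_set_scope.
Local Open Scope ring_scope.
Local Open Scope complex_scope.

Local Notation modulus z := (complex.Re `|z|).

(** * Roots of unity and the unit circle *)
Section RootsOfUnity.

Lemma sum_prim_root_expr (F : fieldType) (n : nat) (w : F) (k : nat) :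
  n.-primitive_root w ->
  \sum_(j < n) w ^+ (j * k) = if (n %| k)%N then n%:R else 0.
Proof.
move=> w_prim; have := prim_order_dvd w_prim k.
case: ifP => _ wk1.
  under eq_bigr do rewrite mulnC exprM (eqP (esym wk1)) expr1n.
  by rewrite sumr_const card_ord.
have : (w ^+ k - 1) * \sum_(j < n) w ^+ (j * k) = 0.
  under eq_bigr do rewrite mulnC exprM.
  by rewrite -subrX1 -exprM mulnC exprM (prim_expr_order w_prim) expr1n subrr.
by move/eqP; rewrite mulf_eq0 subr_eq0 -wk1 => /eqP.
Qed.

End RootsOfUnity.

Section Expi.
Context {R : realType}.
Implicit Types t : R.

Definition expi t : R[i] := cos t +i* sin t.

Lemma expiD s t : expi (s + t) = expi s * expi t.
Proof. by rewrite /expi cosD sinD [sin s * _ + _]addrC. Qed.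

Lemma expi0 : expi 0 = 1.
Proof. by rewrite /expi cos0 sin0. Qed.

Lemma expi_mulrn t n : expi (t *+ n) = expi t ^+ n.
Proof.
by elim: n => [|n IH]; rewrite ?expi0// mulrS expiD exprS IH.
Qed.

Lemma expiD2pi t : expi (t + pi *+ 2) = expi t.
Proof. by rewrite /expi cosD2pi sinD2pi. Qed.

Lemma normr_expi t : `|expi t| = 1.
Proof. by rewrite normc_def /= cos2Dsin2 sqrtr1. Qed.

(** Cosine decreases on [[0, pi]] and the arc [[d, 2 pi - d]] is symmetric about
    [pi], so the maximum on the arc is at its ends. *)
Lemma cos_le_arc d t : 0 <= d -> d <= t -> t <= pi *+ 2 - d -> cos t <= cos d.
Proof.
wlog tpi : t / t <= pi => [H d0 dt td|].
  have [/H|tpi] := leP t pi; first exact.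
  have -> : cos t = cos (pi *+ 2 - t) by rewrite addrC cosD2pi cosN.
  by apply: H => //; lra.
move=> d0; rewrite le_eqVlt => /orP[/eqP->//|dt] _.
by apply/ltW; rewrite ltr_cos// in_itv/=; apply/andP; split; lra.
Qed.

Lemma cos_lt1 t : 0 < t -> t <= pi -> cos t < 1.
Proof.
move=> t0 tpi; rewrite -(@cos0 R) ltr_cos// in_itv/= ?lexx ?pi_ge0//.
by rewrite ltW.
Qed.

(** With [t = 2 pi / n], the angles [t i] for [0 < i < n] lie in
    [[t, 2 pi - t]], where the cosine is at most [cos t < 1]; so no proper power
    is [1]. *)
Lemma expi_prim_root n : (0 < n)%N -> n.-primitive_root (expi (pi *+ 2 / n%:R)).
Proof.
move=> n0; have n0R : 0 < n%:R :> R by rewrite ltr0n.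
pose t : R := pi *+ 2 / n%:R.
have pi0 : 0 < (pi : R) := pi_gt0 R.
have t0 : 0 < t by rewrite divr_gt0// pmulrn_lgt0.
have tn : t *+ n = pi *+ 2 by rewrite -mulr_natr divfK// gt_eqF.
apply/andP; split=> //; apply/forallP => i; apply/eqP.
rewrite unity_rootE -expi_mulrn.
have [->|neq] := eqVneq i.+1 n; first by rewrite tn -[pi *+ 2]add0r expiD2pi expi0 eqxx.
apply/eqP => e1; have lt_in : (i.+1 < n)%N by rewrite ltn_neqAle neq ltn_ord.
have tpi : t <= pi.
  have : t *+ 2 <= t *+ n by rewrite ler_pMn2l//; exact: leq_trans lt_in.
  by rewrite tn; lra.
have : cos (t *+ i.+1) <= cos t.
  apply: cos_le_arc; first exact: ltW.
    by rewrite -[leLHS]mulr1n ler_pMn2l.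
  by rewrite lerBrDr -mulrSr -tn ler_pMn2l.
by have [-> _] := e1; have := cos_lt1 t0 tpi; lra.
Qed.

(** The real part of [expi t - 1] alone has this size on the arc that avoids
    [0] modulo [2 pi]. *)
Lemma norm_expiB1 d t : 0 <= d -> d <= t -> t <= pi *+ 2 - d ->
  (1 - cos d)%:C <= `|expi t - 1|.
Proof.
move=> d0 dt td; apply: le_trans (_ : `|complex.Re (expi t - 1)|%:C <= _).
  have ct := cos_le_arc d0 dt td; rewrite lecR /= distrC ger0_norm; first lra.
  by rewrite subr_ge0 cos_le1.
exact: normc_ge_Re.
Qed.

End Expi.

(** * Modulus and operator norm as real numbers *)
Section ComplexModulus.
Context {R : realType}.
Implicit Types z w : R[i].

Lemma modulusE z : `|z| = (modulus z)%:C.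
Proof. by rewrite RRe_real// normr_real. Qed.

Lemma modulus_ge0 z : 0 <= modulus z.
Proof. by rewrite -ler0c -modulusE. Qed.

Lemma modulusM z w : modulus (z * w) = modulus z * modulus w.
Proof.
have : (modulus (z * w))%:C = (modulus z * modulus w)%:C.
  by rewrite rmorphM -!modulusE normrM.
by case.
Qed.

Lemma modulus_real (r : R) : 0 <= r -> modulus r%:C = r.
Proof. by move=> r0; rewrite ger0_norm ?ler0c. Qed.

Lemma modulus_invn n : modulus ((n%:R : R[i])^-1) = n%:R^-1.
Proof. by rewrite -(rmorph_nat (real_complex R)) -fmorphV modulus_real// invr_ge0. Qed.

Lemma modulus_le (a b : R) : modulus (a +i* b) <= `|a| + `|b|.
Proof.
rewrite normc_def /= -[leRHS]ger0_norm ?addr_ge0// -sqrtr_sqr ler_sqrt.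
  rewrite sqrrD !real_normK ?num_real// addrAC lerDl.
  by rewrite mulrn_wge0// mulr_ge0.
by rewrite sqr_ge0.
Qed.

End ComplexModulus.

Section OperatorNorm.
Context {R : realType} (X : normedModType R[i]).
Implicit Types (A B : bop X) (a : R[i]) (x : X).

Lemma bop_scalerAl a A B : (a *: A) * B = a *: (A * B).
Proof. exact: bopP. Qed.

Lemma bop_scalerAr a A B : A * (a *: B) = a *: (A * B).
Proof. by apply: bopP => x; exact: linearZ. Qed.

Lemma bop_scale1X a n : (a *: (1 : bop X)) ^+ n = a ^+ n *: (1 : bop X).
Proof.
elim: n => [|n IH]; first by rewrite !expr0 scale1r.
by rewrite exprS IH bop_scalerAl mul1r scalerA exprS.
Qed.

(** An inverse [D] of [A - z] commutes with [A]; this form of the common value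
    of [D A] and [A D] is convenient for rewriting. *)
Lemma bop_inverse_mul A D z :
  D * (A - z *: (1 : bop X)) = 1 -> (A - z *: (1 : bop X)) * D = 1 ->
  D * A = 1 + z *: D /\ A * D = 1 + z *: D.
Proof.
rewrite mulrBr mulrBl bop_scalerAr bop_scalerAl mulr1 mul1r.
by move=> /eqP + /eqP; rewrite !subr_eq => /eqP -> /eqP ->.
Qed.

Lemma opnormD A B : opnorm (A + B) <= opnorm A + opnorm B.
Proof. by rewrite -lecR rmorphD/= -!bop_normE ler_normD. Qed.

Lemma opnormN A : opnorm (- A) = opnorm A.
Proof.
have : (opnorm (- A))%:C = (opnorm A)%:C by rewrite -!bop_normE normrN.
by case.
Qed.

Lemma opnormB A B : opnorm (A - B) <= opnorm A + opnorm B.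
Proof. by rewrite -(opnormN B) opnormD. Qed.

Lemma opnormM A B : opnorm (A * B) <= opnorm A * opnorm B.
Proof. by rewrite -lecR rmorphM/= -!bop_normE bop_normM. Qed.

Lemma opnormZ a A : opnorm (a *: A) = modulus a * opnorm A.
Proof.
have Ra : `|a| = (modulus a)%:C by rewrite RRe_real// normr_real.
have : (opnorm (a *: A))%:C = (modulus a * opnorm A)%:C.
  by rewrite rmorphM -!bop_normE normrZ [in LHS]Ra.
by case.
Qed.

Lemma opnorm0 : opnorm (0 : bop X) = 0.
Proof. by apply/eqP; rewrite eq_le opnorm_ge0 opnorm_le// => x; rewrite normr0 mul0r. Qed.

Lemma opnorm1_le : opnorm (1 : bop X) <= 1.
Proof. by apply: opnorm_le => // x; rewrite rmorph1 mul1r. Qed.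

Lemma opnorm1 x : x != 0 -> opnorm (1 : bop X) = 1.
Proof.
move=> x0; apply/eqP; rewrite eq_le opnorm1_le/=.
have := opnormP (1 : bop X) x; rewrite bop1 -[leLHS]mul1r ler_pM2r ?normr_gt0//.
by rewrite -lecR.
Qed.

Lemma opnormX A n : opnorm (A ^+ n) <= opnorm A ^+ n.
Proof.
elim: n => [|n IH]; first by rewrite !expr0 opnorm1_le.
by rewrite !exprS (le_trans (opnormM _ _))// ler_wpM2l// opnorm_ge0.
Qed.

Lemma opnorm_sum (I : Type) (r : seq I) (P : pred I) (F : I -> bop X) :
  opnorm (\sum_(i <- r | P i) F i) <= \sum_(i <- r | P i) opnorm (F i).
Proof.
elim/big_ind2 : _ => [|u A v B uA vB|//]; first by rewrite opnorm0.
by rewrite (le_trans (opnormD _ _))// lerD.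
Qed.

End OperatorNorm.

(** * Nonempty spectrum *)
Lemma compact_locally_bounded (R : realType) (T : topologicalType) (K : set T)
    (f : T -> R) :
  compact K ->
  (forall x, K x -> exists M, \forall y \near x, f y <= M) ->
  exists M, forall x, K x -> f x <= M.
Proof.
move=> /compact_near_coveringP cK fK.
have [|M [_ MK]] := cK R (pinfty_nbhs R) (fun M x => f x <= M) _.
  move=> x /fK[M fM]; exists ([set y | f y <= M], [set N | M <= N]).
    split => //; apply: nbhs_pinfty_ge; exact: num_real.
  by move=> [y N] /= [fyM]; exact: le_trans.
by exists (M + 1) => x Kx; apply: MK => //; rewrite ltrDl.
Qed.

(** In this section [Rs] is a resolvent of [S] defined on the whole plane. The
    goal is that the underlying space is zero. *)
Section NonemptySpectrum.
Context {R : realType} (V : normedModType R[i]) (S : bop V) (Rs : R[i] -> bop V).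
Context (RsK : forall z, Rs z * (z *: (1 : bop V) - S) = 1).
Context (RsVK : forall z, (z *: (1 : bop V) - S) * Rs z = 1).

Lemma resolvent_identity z w : Rs z - Rs w = (w - z) *: (Rs z * Rs w).
Proof.
have -> : (w - z) *: (Rs z * Rs w) =
    Rs z * ((w *: (1 : bop V) - S) - (z *: (1 : bop V) - S)) * Rs w.
  by rewrite opprB addrA subrK -scalerBl bop_scalerAr bop_scalerAl mulr1.
by rewrite mulrBr mulrBl -mulrA RsVK mulr1 RsK mul1r.
Qed.

(** By the resolvent identity [Rs z] differs from [Rs w] by at most
    [|z - w| * opnorm (Rs w) * opnorm (Rs z)], that is, by at most half of
    [opnorm (Rs z)]. *)
Lemma resolvent_locally_bounded z w :
  modulus (z - w) * opnorm (Rs w) <= 2^-1 ->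
  opnorm (Rs z) <= 2 * opnorm (Rs w).
Proof.
move=> zw; have := resolvent_identity z w => /eqP.
rewrite subr_eq addrC => /eqP Rz.
have : opnorm (Rs z) <= opnorm (Rs w) + 2^-1 * opnorm (Rs z).
  rewrite [leLHS](congr1 _ Rz) (le_trans (opnormD _ _))// lerD2l opnormZ distrC.
  have N0 := modulus_ge0 (z - w).
  rewrite (le_trans (ler_wpM2l N0 (opnormM _ _)))//.
  by rewrite mulrCA mulrC ler_wpM2r// opnorm_ge0.
lra.
Qed.

(** Compactness is applied to a square of real pairs, which contains the disc of
    radius [rho] after identification with the complex plane. *)
Lemma resolvent_bounded (rho : R) : exists M, forall a b,
  `|a| <= rho -> `|b| <= rho -> opnorm (Rs (a +i* b)) <= M.
Proof.
have cK : compact (`[-rho, rho] `*` `[-rho, rho] : set (R * R)).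
  by apply: compact_setX; exact: segment_compact.
have [|M KM] := compact_locally_bounded (f := fun p => opnorm (Rs (p.1 +i* p.2))) cK.
  move=> [a b] _; exists (2 * opnorm (Rs (a +i* b))).
  set c := opnorm _; have c0 : 0 <= c by exact: opnorm_ge0.
  have e0 : 0 < (4 * (c + 1))^-1 by rewrite invr_gt0 mulr_gt0// ltr_wpDl.
  near=> p; apply: resolvent_locally_bounded; rewrite -/c.
  have p1 : `|a - p.1| < (4 * (c + 1))^-1.
    near: p; apply: cvgr_dist_lt => //; exact: cvg_fst.
  have p2 : `|b - p.2| < (4 * (c + 1))^-1.
    near: p; apply: cvgr_dist_lt => //; exact: cvg_snd.
  have pe : modulus ((p.1 +i* p.2) - (a +i* b)) <= 2 * (4 * (c + 1))^-1.
    have := modulus_le (p.1 - a) (p.2 - b); rewrite !(distrC p.1) !(distrC p.2).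
    by move=> /le_trans; apply; lra.
  have -> : 2^-1 = 2 * (4 * (c + 1))^-1 * (c + 1) :> R by field; lra.
  by apply: ler_pM => //; rewrite ?lerDl// -ler0c RRe_real ?normr_real.
exists M => a b aM bM; apply: (KM (a, b)).
by split; rewrite /= in_itv /= -ler_norml.
Unshelve. all: by end_near. Qed.

Lemma scaled_resolvent_lipschitz (rho : R) : exists2 L, 0 < L & forall z w,
  modulus z <= rho -> modulus w <= rho ->
  opnorm (z *: Rs z - w *: Rs w) <= L * modulus (z - w).
Proof.
have [M RM] := resolvent_bounded rho.
have {}RM z : modulus z <= rho -> opnorm (Rs z) <= M.
  case: z => a b; rewrite normc_def /= => abrho.
  by apply: RM; apply: le_trans abrho; rewrite -sqrtr_sqr ler_wsqrtr// ?lerDl ?lerDr sqr_ge0.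
have M1 : 0 <= `|M| + `|rho| * `|M| ^+ 2 by rewrite addr_ge0 ?mulr_ge0.
exists (`|M| + `|rho| * `|M| ^+ 2 + 1) => [|z w zr wr]; first by rewrite ltr_wpDl.
have -> : z *: Rs z - w *: Rs w =
    (z - w) *: Rs z + (w * (w - z)) *: (Rs z * Rs w).
  by rewrite -scalerA -resolvent_identity scalerBl scalerBr addrA subrK.
rewrite (le_trans (opnormD _ _))// !opnormZ modulusM (distrC w).
have N0 := modulus_ge0 (z - w).
have Rz : opnorm (Rs z) <= `|M| := le_trans (RM z zr) (ler_norm M).
have Rw : opnorm (Rs w) <= `|M| := le_trans (RM w wr) (ler_norm M).
have RR : opnorm (Rs z * Rs w) <= `|M| ^+ 2.
  by rewrite (le_trans (opnormM _ _))// expr2 ler_pM ?opnorm_ge0.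
have wr' : modulus w <= `|rho| := le_trans wr (ler_norm rho).
have : modulus w * opnorm (Rs z * Rs w) <= `|rho| * `|M| ^+ 2.
  by rewrite ler_pM ?opnorm_ge0 ?modulus_ge0.
nra.
Qed.

(** The mean of [z |-> z (z - S)^-1] over the [n] points [r w^j], where [w] is a
    primitive [n]-th root of unity. It is a discrete version of the Cauchy
    integral of the resolvent over the circle of radius [r]. *)
Definition circle_mean n r : bop V :=
  (n%:R)^-1 *: \sum_(j < n) let z := r%:C * expi (pi *+ 2 / n%:R) ^+ j in z *: Rs z.

(** The mean equals [r^n (r^n - S^n)^-1]. Indeed every point [z] of the mean has
    [z^n = r^n], and [z (z - S)^-1 (z^n - S^n)] is the sum of the
    [z^(n - k) S^k] for [k < n]; averaging over the roots of unity kills all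
    terms but [k = 0]. *)
Lemma circle_meanE n r : (0 < n)%N ->
  circle_mean n r * (r%:C ^+ n *: (1 : bop V) - S ^+ n) = r%:C ^+ n *: (1 : bop V).
Proof.
move=> n0; pose w : R[i] := expi (pi *+ 2 / n%:R); pose z (j : nat) := r%:C * w ^+ j.
have w_prim : n.-primitive_root w := expi_prim_root n0.
have factor (j : 'I_n) : z j *: Rs (z j) * (r%:C ^+ n *: (1 : bop V) - S ^+ n) =
    \sum_(k < n) (r%:C ^+ (n - k) * w ^+ (j * (n - k))) *: S ^+ k.
  have -> : r%:C ^+ n = z j ^+ n :> R[i].
    by rewrite exprMn -exprM mulnC exprM (prim_expr_order w_prim) expr1n mulr1.
  rewrite -bop_scale1X subrXX_comm; last first.
    by rewrite /GRing.comm bop_scalerAl bop_scalerAr mul1r mulr1.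
  rewrite mulrA bop_scalerAl RsK bop_scalerAl mul1r scaler_sumr.
  apply: eq_bigr => k _; rewrite bop_scale1X bop_scalerAl mul1r scalerA.
  rewrite -(exprS (z j)).
  rewrite (_ : (n.-1 - k).+1 = (n - k)%N); last first.
    by rewrite -subSn ?prednK// -ltnS prednK.
  by rewrite exprMn -exprM.
rewrite /circle_mean bop_scalerAl mulr_suml (eq_bigr _ (fun j _ => factor j)) exchange_big/=.
rewrite (eq_bigr (fun k : 'I_n => (k == 0%N :> nat)%:R * n%:R * r%:C ^+ n *: (1 : bop V))); last first.
  move=> k _; rewrite -scaler_suml -mulr_sumr sum_prim_root_expr//.
  have [->|k0] := eqVneq (k : nat) 0%N.
    by rewrite subn0 dvdnn expr0 mul1r mulrC.
  rewrite gtnNdvd ?subn_gt0// ?mulr0 ?mul0r ?scale0r//.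
  by rewrite ltn_subrL lt0n k0.
case: n n0 {w z w_prim factor} => // n _; rewrite big_ord_recl/= big1 => [|i _].
  by rewrite addr0 mul1r scalerA mulrA mulVf ?mul1r// pnatr_eq0.
by rewrite !mul0r scale0r.
Qed.

(** The constant does not depend on [n], which is what makes the means at nearby
    radii comparable for all large powers of [S] at once. *)
Lemma circle_mean_lipschitz rho : exists2 L, 0 < L & forall n r r', (0 < n)%N ->
  0 <= r <= rho -> 0 <= r' <= rho ->
  opnorm (circle_mean n r - circle_mean n r') <= L * `|r - r'|.
Proof.
have [L L0 RL] := scaled_resolvent_lipschitz rho; exists L => // n r r' n0 rr rr'.
rewrite -scalerBr opnormZ -sumrB.
have n0R : 0 < n%:R :> R by rewrite ltr0n.
rewrite modulus_invn ler_pdivrMl// (le_trans (opnorm_sum _ _ _))//.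
have -> : n%:R * (L * `|r - r'|) = \sum_(j < n) L * `|r - r'|.
  by rewrite sumr_const card_ord mulr_natl.
have modz x (j : 'I_n) : modulus (x%:C * expi (pi *+ 2 / n%:R) ^+ j) = `|x|.
  by rewrite modulusM normrX normr_expi expr1n mulr1 normc_def /= expr0n/= addr0 sqrtr_sqr.
apply: ler_sum => j _ /=; rewrite (le_trans (RL _ _ _ _))//.
- by rewrite modz ger0_norm; case/andP: rr.
- by rewrite modz ger0_norm; case/andP: rr'.
- by rewrite -mulrBl -rmorphB modz.
Qed.

Lemma circle_mean0 n : circle_mean n 0 = 0.
Proof.
by rewrite /circle_mean big1 ?scaler0// => j _; rewrite /= rmorph0 mul0r scale0r.
Qed.

Lemma circle_meanB1 n r : (0 < n)%N ->
  r%:C ^+ n *: (circle_mean n r - 1) = circle_mean n r * S ^+ n.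
Proof.
move=> n0; have := circle_meanE r n0.
rewrite mulrBr bop_scalerAr mulr1 => /eqP; rewrite subr_eq => /eqP E.
by rewrite scalerBr E addrAC subrr add0r.
Qed.

Lemma opnorm_circle_meanB1 n r : (0 < n)%N -> 0 <= r ->
  r ^+ n * opnorm (circle_mean n r - 1) <= opnorm (circle_mean n r) * opnorm (S ^+ n).
Proof.
move=> n0 r0; apply: le_trans (opnormM _ _); rewrite -circle_meanB1// opnormZ.
by rewrite -rmorphXn modulus_real// exprn_ge0.
Qed.

(** If [S^n] is small with respect to [r^n], then [r^n (r^n - S^n)^-1] is close
    to [1]. *)
Lemma circle_mean_close1 n r : (0 < n)%N -> 0 < r ->
  opnorm (S ^+ n) <= 10^-1 * r ^+ n -> opnorm (circle_mean n r - 1) <= 9^-1.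
Proof.
move=> n0 r0 Sn; have rn0 : 0 < r ^+ n by rewrite exprn_gt0.
have := opnorm_circle_meanB1 n0 (ltW r0).
have : opnorm (circle_mean n r) <= opnorm (circle_mean n r - 1) + 1.
  rewrite -[X in opnorm X <= _](subrK 1) (le_trans (opnormD _ _))// lerD2l.
  exact: opnorm1_le.
set m := opnorm (circle_mean n r); set d := opnorm (_ - _) => md H.
have m0 : 0 <= m by exact: opnorm_ge0.
have : r ^+ n * d <= r ^+ n * (10^-1 * m).
  rewrite (le_trans H)// (_ : r ^+ n * _ = m * (10^-1 * r ^+ n)); last by ring.
  exact: ler_wpM2l.
rewrite ler_pM2l//; lra.
Qed.

(** Conversely, [S^n] can be recovered from the mean: if the latter is close to
    [1], then [S^n] is small with respect to [r^n]. *)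
Lemma circle_mean_close1_opnorm n r : (0 < n)%N -> 0 < r ->
  opnorm (circle_mean n r - 1) <= 2 / 9 -> opnorm (S ^+ n) < r ^+ n.
Proof.
move=> n0 r0 md; have rn0 : 0 < r ^+ n by rewrite exprn_gt0.
have : opnorm (S ^+ n) <= r ^+ n * opnorm (circle_mean n r - 1) +
    opnorm (circle_mean n r - 1) * opnorm (S ^+ n).
  have {1}-> : S ^+ n = circle_mean n r * S ^+ n - (circle_mean n r - 1) * S ^+ n.
    by rewrite -mulrBl opprB addrCA subrr addr0 mul1r.
  rewrite (le_trans (opnormB _ _))// lerD//; last exact: opnormM.
  rewrite -circle_meanB1// opnormZ -rmorphXn modulus_real// exprn_ge0//.
  exact: ltW.
have := opnorm_ge0 (S ^+ n); have := opnorm_ge0 (circle_mean n r - 1).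
set d := opnorm (_ - _) in md *; set s := opnorm _; nra.
Qed.

(** For [r > 0] this says that [r] exceeds the spectral radius of [S], as the
    infimum of the [n]-th roots of [opnorm (S ^+ n)]. *)
Definition small_power r := exists2 n, (0 < n)%N & opnorm (S ^+ n) < r ^+ n.

Lemma small_powerW r e : 0 < r -> 0 < e -> small_power r ->
  exists2 n, (0 < n)%N & opnorm (S ^+ n) <= e * r ^+ n.
Proof.
move=> r0 e0 [n n0 Sn]; have rn0 : 0 < r ^+ n by rewrite exprn_gt0.
have q0 : 0 <= opnorm (S ^+ n) / r ^+ n by rewrite divr_ge0 ?opnorm_ge0// ltW.
have q1 : opnorm (S ^+ n) / r ^+ n < 1 by rewrite ltr_pdivrMr// mul1r.
have /cvgr0Pnorm_le /(_ _ e0) [m _ /(_ m.+1 (leqnSn m))/=] :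
    (GRing.exp (opnorm (S ^+ n) / r ^+ n) : R ^nat) @ \oo --> 0.
  by apply: cvg_expr; rewrite ger0_norm.
rewrite ger0_norm ?exprn_ge0// expr_div_n ler_pdivrMr ?exprn_gt0// => qm.
exists (n * m.+1)%N; first by rewrite muln_gt0 n0.
by rewrite !exprM (le_trans (opnormX _ _)).
Qed.

(** Smallness of a power passes from [r] to any nearby [r']: at [r] it
    makes the mean close to [1] for a suitable [n], the uniform Lipschitz bound
    transports this to [r'], and there it gives smallness of [S^n] back. The
    radius [0] cannot be reached, because the mean vanishes there. The
    distance to [1] is at most [1 / 9] at [r], hence [2 / 9] at [r']. *)
Lemma small_power_step (x : V) rho L r r' : x != 0 ->
  (forall n r r', (0 < n)%N -> 0 <= r <= rho -> 0 <= r' <= rho ->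
    opnorm (circle_mean n r - circle_mean n r') <= L * `|r - r'|) ->
  0 < r <= rho -> 0 <= r' <= rho -> L * `|r - r'| <= 9^-1 ->
  small_power r -> 0 < r' /\ small_power r'.
Proof.
move=> x0 meanL /andP[r0 rrho] rrho' rr'.
have e0 : 0 < 10^-1 :> R by rewrite invr_gt0.
move=> /(small_powerW r0 e0)[n n0 Sn].
have mr := circle_mean_close1 n0 r0 Sn.
have mr' : opnorm (circle_mean n r' - 1) <= 2 / 9.
  have -> : circle_mean n r' - 1 = circle_mean n r - 1 - (circle_mean n r - circle_mean n r').
    by rewrite opprB [RHS]addrC addrA subrK.
  rewrite (le_trans (opnormB _ _))//.
  have := meanL n r r' n0 _ rrho'; rewrite ltW//= => /(_ rrho); lra.
have r'0 : 0 < r'.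
  rewrite lt_neqAle; case/andP: rrho' => -> _; rewrite andbT eq_sym.
  apply/eqP => r'0; move: mr'; rewrite r'0 circle_mean0 sub0r opnormN (opnorm1 x0); lra.
by split => //; exists n => //; exact: circle_mean_close1_opnorm.
Qed.

(** Smallness holds at [opnorm S + 1] and can be propagated downwards by steps of
    fixed length [d], always at positive radii: a contradiction after finitely
    many steps. *)
Lemma everywhere_resolvent_trivial (x : V) : x = 0.
Proof.
apply: contrapT => /eqP x0; pose rho := opnorm S + 1.
have S0 := opnorm_ge0 S.
have [L L0 meanL] := circle_mean_lipschitz rho; pose d := (9 * L)^-1.
have d0 : 0 < d by rewrite invr_gt0 mulr_gt0.
have down k : 0 < rho - d *+ k /\ small_power (rho - d *+ k).
  elim: k => [|k [rk0 Sk]].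
    by rewrite mulr0n subr0; split; [rewrite ltr_wpDl|exists 1%N; rewrite // !expr1 ltrDl].
  have dk : 0 <= d *+ k by rewrite mulrn_wge0// ltW.
  (* Truncation at [0] keeps [r'] admissible; the step lemma excludes [r' = 0]. *)
  pose r' := Num.max (rho - d *+ k.+1) 0.
  have [|||r'0 Sr'] := small_power_step (r' := r') x0 meanL _ _ _ Sk.
  - by rewrite rk0 gerBl.
  - by rewrite le_max lexx orbT ge_max gerBl mulrn_wge0 ?(ltW d0)//= /rho addr_ge0.
  - have : `|rho - d *+ k - r'| <= d.
      rewrite /r' mulrS ler_norml; case: (leP (rho - (d + d *+ k)) 0) => ?;
        by apply/andP; split; lra.
    rewrite -(ler_pM2l L0) => /le_trans; apply.
    by rewrite /d invfM mulrCA divff ?gt_eqF// mulr1.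
  by move: r'0 Sr'; rewrite /r'; case: (leP (rho - d *+ k.+1) 0) => _; rewrite ?ltxx.
have [k] : exists k : nat, rho / d < k%:R.
  exists (Num.bound (rho / d)); rewrite archi_boundP// divr_ge0 ?ltW// /rho.
  by rewrite ltr_wpDl.
rewrite ltr_pdivrMr// mulr_natl; have [+ _] := down k; lra.
Qed.

End NonemptySpectrum.

Lemma bop_spectrum_nonempty (R : realType) (V : normedModType R[i]) (S : bop V) (x : V) :
  x != 0 -> bop_spectrum S !=set0.
Proof.
move=> x0; apply: contrapT => /set0P/negP/negPn/eqP S0.
have inv z : exists D : bop V, D * (z *: (1 : bop V) - S) = 1 /\ (z *: (1 : bop V) - S) * D = 1.
  have : ~ bop_spectrum S z by rewrite S0.
  move=> /contrapT[D [DS SD]]; exists (- D).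
  by rewrite -[_ - S]opprB !mulrNN.
have [Rs RsP] := choice inv.
move/eqP: x0; apply.
exact: (@everywhere_resolvent_trivial _ _ S Rs (fun z => (RsP z).1) (fun z => (RsP z).2)).
Qed.

(** * Intertwiners and Sylvester's equation *)

(** The solutions of [A Y = Y C] are made into a normed space of their own, so
    that the spectrum of an operator acting on them makes sense. *)
Section Intertwiners.
Context {R : realType} (X : normedModType R[i]) (A C : bop X).

Definition intertwining : {pred bop X} := [pred Y | A * Y == Y * C].

Lemma intertwiningP Y : reflect (A * Y = Y * C) (Y \in intertwining).
Proof. by rewrite inE; exact: eqP. Qed.

Record intertwiner := Intertwiner {
  intertwiner_val : bop X; _ : intertwiner_val \in intertwining }.

HB.instance Definition _ := [isSub for intertwiner_val].
HB.instance Definition _ := [Choice of intertwiner by <:].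

Lemma intertwining_submod_closed : submod_closed intertwining.
Proof.
split; first by apply/intertwiningP; rewrite mulr0 mul0r.
move=> a Y Z /intertwiningP AY /intertwiningP AZ; apply/intertwiningP.
by rewrite mulrDr mulrDl bop_scalerAr bop_scalerAl AY AZ.
Qed.

HB.instance Definition _ := GRing.isSubmodClosed.Build _ _ intertwining
  intertwining_submod_closed.
HB.instance Definition _ := [SubChoice_isSubLmodule of intertwiner by <:].

Definition intertwiner_norm (Y : intertwiner) : R[i] := `|\val Y|.

Let normD Y Z : intertwiner_norm (Y + Z) <= intertwiner_norm Y + intertwiner_norm Z.
Proof. exact: ler_normD. Qed.

Let normZ a Y : intertwiner_norm (a *: Y) = `|a| * intertwiner_norm Y.
Proof. exact: normrZ. Qed.

Let norm0_eq0 Y : intertwiner_norm Y = 0 -> Y = 0.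
Proof. by move=> /normr0_eq0 Y0; apply: val_inj. Qed.

HB.instance Definition _ := isPointed.Build intertwiner 0.
HB.instance Definition _ :=
  Lmodule_isNormed.Build R[i] intertwiner normD normZ norm0_eq0.

Lemma intertwiner_bop (f : bop X -> bop X) (M : R) :
  linear f -> (forall Y, `|f Y| <= M%:C * `|Y|) ->
  (forall Y, Y \in intertwining -> f Y \in intertwining) ->
  exists F : bop intertwiner, forall Y, \val (F Y) = f (\val Y).
Proof.
move=> f_lin f_bnd f_stable.
pose F (Y : intertwiner) : intertwiner := Intertwiner (f_stable _ (valP Y)).
have FP : F \in @bounded_linear R intertwiner.
  apply/bounded_linearP; split; last by exists M => Y; exact: f_bnd.
  by move=> a Y Z; apply: val_inj; rewrite /= f_lin.
by exists (Bop FP).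
Qed.

Lemma intertwiner_bop_mull (D : bop X) :
  (forall Y, Y \in intertwining -> D * Y \in intertwining) ->
  exists F : bop intertwiner, forall Y, \val (F Y) = D * \val Y.
Proof.
move=> Dst; apply: (intertwiner_bop (f := fun Y => D * Y) (M := opnorm D)) => // [a Y Z|Y].
  by rewrite mulrDr bop_scalerAr.
by rewrite -bop_normE bop_normM.
Qed.

Lemma intertwiner_bop_mulr (D : bop X) :
  (forall Y, Y \in intertwining -> Y * D \in intertwining) ->
  exists F : bop intertwiner, forall Y, \val (F Y) = \val Y * D.
Proof.
move=> Dst; apply: (intertwiner_bop (f := fun Y => Y * D) (M := opnorm D)) => // [a Y Z|Y].
  by rewrite mulrDl bop_scalerAl.
by rewrite -bop_normE mulrC bop_normM.
Qed.

(** On intertwiners, left multiplication by [A] agrees with right multiplication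
    by [C]. Hence the inverse of its translate by [z] is left multiplication by
    [(A - z)^-1] or right multiplication by [(C - z)^-1], whichever exists. *)
Lemma sylvester_inj (Y : bop X) :
  (forall z, bop_spectrum A z -> ~ bop_spectrum C z) ->
  A * Y = Y * C -> Y = 0.
Proof.
move=> disj AY; apply: contrapT => /eqP Y0.
have [|S SE] := @intertwiner_bop_mull A.
  by move=> Z /intertwiningP AZ; apply/intertwiningP; rewrite AZ mulrA AZ.
pose y := Intertwiner (introT (intertwiningP Y) AY).
have y0 : y != 0 by apply: contra Y0 => /eqP/(congr1 val)/= ->.
have [z] := bop_spectrum_nonempty S y0; apply.
have SzE (Z : intertwiner) :
    \val ((S - z *: (1 : bop intertwiner)) Z) = A * \val Z - z *: \val Z.
  by rewrite bopB raddfB /= SE.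
have [[D [DA AD]]|] := pselect (bop_invertible (A - z *: (1 : bop X))).
  have [{}DA {}AD] := bop_inverse_mul DA AD.
  have [|F FE] := @intertwiner_bop_mull D.
    move=> Z /intertwiningP AZ; apply/intertwiningP.
    by rewrite mulrA AD -DA -!mulrA AZ.
  exists F; split; apply: bopP => Z; apply: val_inj.
    rewrite bopM FE SzE mulrBr bop_scalerAr mulrA.
    by rewrite DA mulrDl mul1r bop_scalerAl addrK.
  rewrite bopM SzE FE mulrA AD mulrDl mul1r.
  by rewrite bop_scalerAl addrK.
move=> /disj/contrapT[D [DC CD]].
have [{}DC {}CD] := bop_inverse_mul DC CD.
have [|F FE] := @intertwiner_bop_mulr D.
  move=> Z /intertwiningP AZ; apply/intertwiningP.
  by rewrite mulrA AZ -!mulrA CD DC.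
have AE (Z : intertwiner) : A * \val Z = \val Z * C by apply/intertwiningP/valP.
exists F; split; apply: bopP => Z; apply: val_inj.
  rewrite bopM FE SzE AE mulrBl bop_scalerAl.
  by rewrite -mulrA CD mulrDr mulr1 bop_scalerAr addrK.
rewrite bopM SzE FE mulrA AE -mulrA CD mulrDr.
by rewrite mulr1 bop_scalerAr addrK.
Qed.

End Intertwiners.

Section CommutatorEigenvectors.
Context {R : realType} (X : normedModType R[i]).

(** The equation says that [Y] intertwines [A] and [A + l], and the spectrum of
    [A + l] is that of [A] translated by [l]. *)
Lemma commutator_eigenvector_eq0 (A Y : bop X) (l : R[i]) :
  (forall z, bop_spectrum A z -> ~ bop_spectrum A (z - l)) ->
  A * Y - Y * A = l *: Y -> Y = 0.
Proof.
move=> disj AY.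
apply: (@sylvester_inj _ _ A (A + l *: (1 : bop X))) => [z Az Alz|]; last first.
  by rewrite mulrDr bop_scalerAr mulr1 -AY addrC subrK.
apply: (disj z Az); move: Alz; rewrite /bop_spectrum /=.
by rewrite scalerBl opprB addrA addrAC.
Qed.

End CommutatorEigenvectors.

(** * The exponential of a sum *)

(** The square of indices [i, j < n] consists of the triangle [i + j < n], which
    the second sum enumerates by diagonals, and of the rest. *)
Lemma cauchy_product_defect (Z : zmodType) (u : nat -> nat -> Z) (n : nat) :
  \sum_(i < n) \sum_(j < n) u i j - \sum_(k < n) \sum_(i < k.+1) u i (k - i)%N =
  \sum_(i < n) \sum_(j < n | (n <= i + j)%N) u i j.
Proof.
have -> : \sum_(k < n) \sum_(i < k.+1) u i (k - i)%N =
    \sum_(i < n) \sum_(j < n | (i + j < n)%N) u i j.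
  (* Each diagonal is completed to a double sum over the square. *)
  transitivity (\sum_(k < n) \sum_(i < n) \sum_(j < n | (i + j == k)%N) u i j).
    apply: eq_bigr => k _.
    rewrite (big_ord_widen _ (fun i => u i (k - i)%N) (ltn_ord k)) big_mkcond/=.
    apply: eq_bigr => i _; case: ltnP => [ik|ki]; last first.
      by rewrite big_pred0// => j; apply/eqP; lia.
    have kin : (k - i < n)%N by have := ltn_ord k; lia.
    rewrite (big_pred1 (Ordinal kin)) => [//|j].
    by apply/eqP/eqP => [?|->/=]; [apply: val_inj => /=|]; lia.
  rewrite exchange_big/=; apply: eq_bigr => i _.
  under eq_bigr do rewrite big_mkcond.
  rewrite exchange_big/= [RHS]big_mkcond; apply: eq_bigr => j _ /=.
  rewrite -big_mkcond/=; case: ltnP => [ijn|nij].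
    by rewrite (big_pred1 (Ordinal ijn)).
  by rewrite big_pred0// => k; apply/eqP; have := ltn_ord k; lia.
rewrite -sumrB; apply: eq_bigr => i _.
rewrite [X in X - _](bigID (fun j : 'I_n => (i + j < n)%N))/= addrAC subrr add0r.
by apply: eq_bigl => j; rewrite -leqNgt.
Qed.

Section Exponential.
Context {R : realType}.

Definition exp_partial (X : normedModType R[i]) (A : bop X) (n : nat) : bop X :=
  series (fun n : nat => (n`!%:R : R[i])^-1 *: A ^+ n) n.

Lemma exp_partialE (X : normedModType R[i]) (A : bop X) n :
  exp_partial A n = \sum_(k < n) (k`!%:R : R[i])^-1 *: A ^+ k.
Proof. by rewrite /exp_partial /series /= big_mkord. Qed.

Lemma opnorm_exp_coeff (X : normedModType R[i]) (A : bop X) n :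
  opnorm ((n`!%:R : R[i])^-1 *: A ^+ n) <= exp_coeff (opnorm A) n.
Proof.
by rewrite opnormZ modulus_invn /exp_coeff /= mulrC ler_wpM2r// opnormX.
Qed.

Lemma exp_partial_cvg (X : completeNormedModType R[i]) (A : bop X) :
  exp_partial A @ \oo --> bop_exp A.
Proof.
apply/cauchy_cvgP/cauchy_seriesP => e e0.
have eE : e = (complex.Re e)%:C by rewrite RRe_real// gtr0_real.
have e0R : 0 < complex.Re e by rewrite -ltcR -eE.
have /cauchy_cvgP/cauchy_seriesP/(_ _ e0R) := is_cvg_series_exp_coeff (opnorm A).
apply: filterS => n /=; rewrite bop_normE eE ltcR; apply: le_lt_trans.
rewrite ger0_norm; last by rewrite sumr_ge0// => k _; rewrite exp_coeff_ge0// opnorm_ge0.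
rewrite (le_trans (opnorm_sum _ _ _))//; apply: ler_sum => k _.
exact: opnorm_exp_coeff.
Qed.

Section Convergence.
Context (X : normedModType R[i]).

Lemma cvg_opnormP (F : nat -> bop X) (L : bop X) :
  F @ \oo --> L <-> (fun n => opnorm (L - F n)) @ \oo --> (0 : R).
Proof.
split=> [/cvgrPdist_le FL|/cvgr0Pnorm_le FL].
  apply/cvgr0Pnorm_le => e e0; have e0C : 0 < e%:C by rewrite ltcR.
  apply: filterS (FL _ e0C) => n /=; rewrite bop_normE lecR.
  by rewrite ger0_norm// opnorm_ge0.
apply/cvgrPdist_le => e e0.
have eE : e = (complex.Re e)%:C by rewrite RRe_real// gtr0_real.
have e0R : 0 < complex.Re e by rewrite -ltcR -eE.
apply: filterS (FL _ e0R) => n /=; rewrite bop_normE eE lecR.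
by rewrite ger0_norm// opnorm_ge0.
Qed.

Lemma cvg_bopM (F G : nat -> bop X) (L M : bop X) :
  F @ \oo --> L -> G @ \oo --> M -> (fun n => F n * G n) @ \oo --> L * M.
Proof.
move=> /cvg_opnormP FL /cvg_opnormP GM; apply/cvg_opnormP.
apply: (@squeeze_cvgr _ _ _ _ (cst 0) (fun n => opnorm (L - F n) *
    (opnorm M + opnorm (M - G n)) + opnorm L * opnorm (M - G n))).
- near=> n; rewrite /= opnorm_ge0/=.
  have -> : L * M - F n * G n = (L - F n) * G n + L * (M - G n).
    by rewrite mulrBl mulrBr [RHS]addrC addrA subrK.
  rewrite (le_trans (opnormD _ _))// lerD ?(le_trans (opnormM _ _))//.
  rewrite ler_wpM2l ?opnorm_ge0//.
  by rewrite -[X in opnorm X <= _](subKr M) opnormB.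
- exact: cvg_cst.
- rewrite -[X in _ --> X](_ : 0 * (opnorm M + 0) + opnorm L * 0 = 0); last by ring.
  by apply: cvgD; apply: cvgM => //; [apply: cvgD => //|]; exact: cvg_cst.
Unshelve. all: by end_near. Qed.

Lemma cvg_bop_apply (F : nat -> bop X) (L : bop X) x :
  F @ \oo --> L -> (fun n => F n x) @ \oo --> L x.
Proof.
move=> /cvgrPdist_lt FL; apply/cvgrPdist_lt => e e0.
have x1 : 0 < `|x| + 1 by rewrite ltr_wpDl.
have := FL _ (divr_gt0 e0 x1); apply: filterS => n; rewrite ltr_pdivlMr//.
apply: le_lt_trans; rewrite -bopB (le_trans (bop_norm_le _ _))// ler_wpM2l//.
by rewrite lerDl.
Qed.

Lemma norm_lim_le (u : nat -> X) (l : X) (M : R[i]) :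
  u @ \oo --> l -> (forall n, `|u n| <= M) -> `|l| <= M.
Proof.
move=> /cvgrPdist_le ul uM; apply/ler_addgt0Pr => e e0.
near \oo => n; rewrite -(subrK (u n) l) (le_trans (ler_normD _ _))// addrC lerD//.
by near: n; exact: ul.
Unshelve. all: by end_near. Qed.

End Convergence.

Section ExpD.
Context (X : completeNormedModType R[i]).
Implicit Types A B : bop X.

Lemma exp_partial_cauchy_product A B n : A * B = B * A ->
  exp_partial A n * exp_partial B n - exp_partial (A + B) n =
  \sum_(i < n) \sum_(j < n | (n <= i + j)%N)
    ((i`!%:R : R[i])^-1 * (j`!%:R)^-1) *: (A ^+ i * B ^+ j).
Proof.
move=> AB; rewrite -(cauchy_product_defect (fun i j =>
  ((i`!%:R : R[i])^-1 * (j`!%:R)^-1) *: (A ^+ i * B ^+ j))) !exp_partialE.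
congr (_ - _).
  rewrite mulr_suml; apply: eq_bigr => i _; rewrite mulr_sumr.
  by apply: eq_bigr => j _; rewrite bop_scalerAl bop_scalerAr scalerA.
apply: eq_bigr => k _; rewrite [A + B]addrC exprDn_comm; last exact: esym.
rewrite scaler_sumr; apply: eq_bigr => i _.
have ik : (i <= k)%N by rewrite -ltnS.
rewrite -[X in _ *: X](@scaler_nat R[i]) scalerA.
have -> : B ^+ (k - i) * A ^+ i = A ^+ i * B ^+ (k - i).
  by apply: commrX; apply: commr_sym; exact: commrX.
congr (_ *: _).
have f0 m : (m`!%:R : R[i]) != 0 by rewrite pnatr_eq0 -lt0n fact_gt0.
rewrite -(bin_fact ik) !natrM; field.
by rewrite !f0 pnatr_eq0 -lt0n bin_gt0 ik.
Qed.

Lemma exp_coeff_cauchy_product (a b : R) n :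
  series (exp_coeff a) n * series (exp_coeff b) n - series (exp_coeff (a + b)) n =
  \sum_(i < n) \sum_(j < n | (n <= i + j)%N) (i`!%:R^-1 * j`!%:R^-1) * (a ^+ i * b ^+ j).
Proof.
rewrite -(cauchy_product_defect (fun i j =>
  (i`!%:R^-1 * j`!%:R^-1) * (a ^+ i * b ^+ j))) /series /= !big_mkord.
congr (_ - _).
  rewrite mulr_suml; apply: eq_bigr => i _; rewrite mulr_sumr.
  by apply: eq_bigr => j _; rewrite /exp_coeff/=; ring.
apply: eq_bigr => k _; rewrite /exp_coeff/= [a + b]addrC exprDn mulr_suml.
apply: eq_bigr => i _; have ik : (i <= k)%N by rewrite -ltnS.
have f0 m : (m`!%:R : R) != 0 by rewrite pnatr_eq0 -lt0n fact_gt0.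
rewrite -mulr_natr -(bin_fact ik) !natrM; field.
by rewrite !f0 pnatr_eq0 -lt0n bin_gt0 ik.
Qed.

(** The product of the partial sums for [A] and [B] differs from the partial sum
    for [A + B] by a sum with nonnegative coefficients of monomials [A^i B^j].
    Replacing [A] and [B] by their norms gives a majorant, which is the same
    difference for the real exponential; so it tends to [0] by the functional
    equation of the latter. *)
Theorem bop_expD A B : A * B = B * A -> bop_exp (A + B) = bop_exp A * bop_exp B.
Proof.
move=> AB.
apply: (@cvg_unique _ (@norm_hausdorff _ (bop X)) _ _ _ _ (@exp_partial_cvg _ (A + B))).
have AcB := cvg_bopM (@exp_partial_cvg _ A) (@exp_partial_cvg _ B).
pose D n := exp_partial A n * exp_partial B n - exp_partial (A + B) n.
have D0 : D @ \oo --> (0 : bop X).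
  apply/cvg_opnormP.
  apply: (@squeeze_cvgr _ _ _ _ (cst 0) (fun n =>
    series (exp_coeff (opnorm A)) n * series (exp_coeff (opnorm B)) n -
    series (exp_coeff (opnorm A + opnorm B)) n)).
  - near=> n; rewrite /= opnorm_ge0 sub0r opnormN/= /D.
    rewrite exp_partial_cauchy_product// exp_coeff_cauchy_product.
    rewrite (le_trans (opnorm_sum _ _ _))//; apply: ler_sum => i _.
    rewrite (le_trans (opnorm_sum _ _ _))//; apply: ler_sum => j _.
    rewrite opnormZ modulusM !modulus_invn ler_wpM2l ?mulr_ge0//.
    by rewrite (le_trans (opnormM _ _))// ler_pM ?opnorm_ge0 ?opnormX.
  - exact: cvg_cst.
  - rewrite -(subrr (expR (opnorm A + opnorm B))) {1}expRD.
    by apply: cvgB; [apply: cvgM|]; exact: is_cvg_series_exp_coeff.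
have -> : exp_partial (A + B) = (fun n => exp_partial A n * exp_partial B n - D n).
  by apply/funext => n; rewrite /D subKr.
have := cvgB AcB D0; rewrite subr0; exact.
Unshelve. all: by end_near. Qed.

End ExpD.
End Exponential.

(** * Values of the exponential *)
Section ExponentialValues.
Context {R : realType} (X : completeNormedModType R[i]).
Implicit Types (A B : bop X) (x y : X).

Lemma expi_coeff (t : R) n :
  (n`!%:R : R[i])^-1 * (0 +i* t) ^+ n = cos_coeff t n +i* sin_coeff t n.
Proof.
have itE m : (0 +i* t) ^+ m.*2 = ((-1) ^+ m * t ^+ m.*2)%:C :> R[i].
  rewrite -!mul2n !exprM -exprMn rmorphXn; congr (_ ^+ _).
  by rewrite !expr2; simpc.
have -> : (n`!%:R : R[i])^-1 = (n`!%:R^-1)%:C.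
  by rewrite fmorphV (rmorph_nat (real_complex R)).
rewrite /cos_coeff /sin_coeff /= -exprnP.
have := odd_double_half n; set m := n./2; case: (odd n) => /= nE.
  have -> : n.-1./2 = m by rewrite -nE add1n /= doubleK.
  rewrite -{2}nE exprD itE expr1 -nE; simpc.
  rewrite !add1n exprS; congr (_ +i* _); ring.
rewrite -{2}nE add0n itE -{1}nE; simpc.
by rewrite -nE; congr (_ +i* _); ring.
Qed.

Lemma bop_exp_imag (t : R) : bop_exp ((0 +i* t) *: (1 : bop X)) = expi t *: (1 : bop X).
Proof.
apply: (@cvg_unique _ (@norm_hausdorff _ (bop X)) _ _ _ _
  (@exp_partial_cvg _ _ ((0 +i* t) *: (1 : bop X)))).
have -> : exp_partial ((0 +i* t) *: (1 : bop X)) =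
    fun n => (series (cos_coeff t) n +i* series (sin_coeff t) n) *: (1 : bop X).
  apply/funext => n; rewrite exp_partialE /series/= !big_mkord.
  rewrite (eq_bigr (fun k : 'I_n => (cos_coeff t k +i* sin_coeff t k) *: (1 : bop X))).
    rewrite -scaler_suml; congr (_ *: _).
    by elim/big_ind3 : _ => // a b c d e f -> ->; simpc.
  by move=> k _; rewrite bop_scale1X scalerA expi_coeff.
apply/cvg_opnormP.
have c_cvg : series (cos_coeff t) @ \oo --> cos t.
  by rewrite unlock; exact: is_cvg_series_cos_coeff.
have s_cvg : series (sin_coeff t) @ \oo --> sin t.
  by rewrite unlock; exact: is_cvg_series_sin_coeff.
apply: (@squeeze_cvgr _ _ _ _ (cst 0) (fun n =>
  `|cos t - series (cos_coeff t) n| + `|sin t - series (sin_coeff t) n|)).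
- near=> n; rewrite /= opnorm_ge0/= -scalerBl opnormZ.
  rewrite (le_trans (ler_wpM2l (modulus_ge0 _) (opnorm1_le X)))// mulr1.
  exact: modulus_le.
- exact: cvg_cst.
- rewrite -[X in _ --> X](_ : `|cos t - cos t| + `|sin t - sin t| = 0).
    by apply: cvgD; apply: cvg_norm; apply: cvgB => //; exact: cvg_cst.
  by rewrite !subrr normr0 addr0.
Unshelve. all: by end_near. Qed.

Lemma bop_exp0 : bop_exp (0 : bop X) = 1.
Proof. by have := bop_exp_imag 0; rewrite expi0 !scale1r => <-; rewrite scale0r. Qed.

Lemma bop_exp_mulrn A n : bop_exp (A *+ n) = bop_exp A ^+ n.
Proof.
elim: n => [|n IH]; first by rewrite mulr0n bop_exp0.
by rewrite mulrS bop_expD ?IH ?exprS// mulrnAl mulrnAr.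
Qed.

Lemma bop_expN A : bop_exp (- A) * bop_exp A = 1.
Proof. by rewrite -bop_expD ?addNr ?bop_exp0// mulNr mulrN. Qed.

Lemma bop_exp_comm A B : A * B = B * A -> bop_exp A * B = B * bop_exp A.
Proof.
move=> AB.
have BB : (cst B : nat -> bop X) @ \oo --> B by exact: cvg_cst.
have L := cvg_bopM (@exp_partial_cvg _ _ A) BB.
have M := cvg_bopM BB (@exp_partial_cvg _ _ A).
suff E : (fun n => exp_partial A n * cst B n) = (fun n => cst B n * exp_partial A n).
  by rewrite E in L; exact: (@cvg_unique _ (@norm_hausdorff _ (bop X)) _ _ _ _ L M).
apply/funext => n; rewrite /= !exp_partialE mulr_suml mulr_sumr.
apply: eq_bigr => k _; rewrite bop_scalerAl bop_scalerAr; congr (_ *: _).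
by apply/esym; apply: commrX.
Qed.

(** For [k >= 2] the term [S^k x / k!] is [S^(k - 1) / k!] applied to [S x], and
    it is at most [2^-k |S x|], because [k! >= 2] and [opnorm S <= 1 / 2]. These
    bounds sum to [|S x| / 2]. *)
Lemma bop_exp_small S x : opnorm S <= 2^-1 ->
  `|bop_exp S x - x - S x| <= 2^-1 * `|S x|.
Proof.
move=> S2.
(* The series of [(e^S - 1 - S) / S]. *)
pose G n := \sum_(k < n) (k.+2`!%:R : R[i])^-1 *: S ^+ k.+1.
have GE n : exp_partial S (n + 2) = 1 + S + G n * S.
  rewrite addn2 exp_partialE !big_ord_recl /= !fact0 invr1 !scale1r expr0 expr1 addrA.
  congr (_ + _); rewrite mulr_suml; apply: eq_bigr => k _.
  by rewrite bop_scalerAl -exprSr.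
apply: (@norm_lim_le _ _ (fun n => exp_partial S (n + 2) x - x - S x)).
  apply: cvgB; last exact: cvg_cst.
  apply: cvgB; last exact: cvg_cst.
  have := @cvg_bop_apply _ _ _ _ x (@exp_partial_cvg _ _ S).
  by rewrite -(cvg_shiftn 2).
move=> n; rewrite GE !bopD bop1 bopM -addrA -opprD [_ + G n _]addrC addrK.
rewrite (le_trans (bop_norm_le _ _))// ler_wpM2r// bop_normE.
suff : opnorm (G n) <= 2^-1.
  rewrite -lecR fmorphV (rmorph_nat (real_complex R)); exact.
rewrite (le_trans (opnorm_sum _ _ _))//.
apply: (@le_trans _ _ (2^-1 * (1 - 2^-1 ^+ n))); last first.
  by rewrite ler_piMr// gerBl exprn_ge0.
elim: n => [|n IH]; first by rewrite big_ord0 expr0 subrr mulr0.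
rewrite big_ord_recr /=.
have : opnorm ((n.+2`!%:R : R[i])^-1 *: S ^+ n.+1) <= 2^-1 * 2^-1 ^+ n.+1.
  rewrite opnormZ modulus_invn ler_pM ?opnorm_ge0//.
    rewrite lef_pV2 ?posrE ?ltr0n ?fact_gt0// (ler_nat _ 2).
    exact: leq_trans (fact_geq n.+2).
  by rewrite (le_trans (opnormX _ _))// lerXn2r ?nnegrE ?opnorm_ge0.
have := exprS (2^-1 : R) n; lra.
Qed.

End ExponentialValues.

(** * Fixed vectors of an exponential *)
Section FixedVectors.
Context {R : realType}.

(** The sum over [k] of [w^(j k) U^k x] is an eigenvector of [U] for [w^(- j)],
    because the summation is cyclic. Fourier inversion says that these
    eigenvectors add up to [n x]; as only the one for [j = 0] is nonzero, [n x]
    is itself fixed. *)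
Lemma fixed_by_fourier (V : normedModType R[i]) (U : bop V) (n : nat) (w : R[i]) (x : V) :
  n.-primitive_root w -> (U ^+ n) x = x ->
  (forall j, (0 < j < n)%N -> forall y, w ^+ j *: U y = y -> y = 0) ->
  U x = x.
Proof.
move=> w_prim Unx only0; have n0 := prim_order_gt0 w_prim.
pose y j := \sum_(k < n) w ^+ (j * k) *: (U ^+ k) x.
(* The terms for [k = 0] and [k = n] agree because [U^n x = x]. *)
have y_eig j : w ^+ j *: U (y j) = y j.
  rewrite /y linear_sum scaler_sumr.
  have shift (k : 'I_n) : w ^+ j *: U (w ^+ (j * k) *: (U ^+ k) x) =
      w ^+ (j * k.+1) *: (U ^+ k.+1) x.
    by rewrite linearZ scalerA -exprD -mulnS [U ^+ k.+1]exprS.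
  rewrite (eq_bigr _ (fun k _ => shift k)) {shift}.
  case: n n0 w_prim Unx {only0 y} => // n _ w_prim Unx.
  rewrite big_ord_recr [RHS]big_ord_recl /= Unx muln0 expr0 scale1r addrC.
  by rewrite mulnC exprM (prim_expr_order w_prim) expr1n scale1r.
have y_sum : \sum_(j < n) y j = n%:R *: x.
  rewrite /y exchange_big /=.
  under eq_bigr do rewrite -scaler_suml sum_prim_root_expr//.
  rewrite (bigD1 (Ordinal n0)) //= dvdn0 big1 ?addr0// => k k0.
  by rewrite gtnNdvd ?scale0r// lt0n.
have y0 : y 0%N = n%:R *: x.
  rewrite -y_sum (bigD1 (Ordinal n0)) //= big1 ?addr0// => j j0.
  by apply: only0 (y_eig j); rewrite lt0n j0 ltn_ord.
have := y_eig 0%N; rewrite expr0 scale1r y0 linearZ.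
apply: scalerI; rewrite pnatr_eq0 -lt0n //.
Qed.

Context (V : completeNormedModType R[i]).
Implicit Types (S T : bop V) (x y : V).

(** Here [e^S y - y = 0] is within [|S y| / 2] of [S y]. *)
Lemma bop_exp_fixed_small S y : opnorm S <= 2^-1 -> bop_exp S y = y -> S y = 0.
Proof.
move=> S2 Sy; have := bop_exp_small y S2.
rewrite Sy subrr sub0r normrN => H; apply/eqP; rewrite -normr_le0.
have : (1 - 2^-1) * `|S y| <= 0 by rewrite mulrBl mul1r subr_le0.
by rewrite pmulr_rle0// subr_gt0 invf_lt1// ltr1n.
Qed.

Lemma bop_expDimag S (t : R) :
  bop_exp (S + (0 +i* t) *: (1 : bop V)) = expi t *: bop_exp S.
Proof.
rewrite bop_expD ?bop_exp_imag; last by rewrite bop_scalerAr bop_scalerAl mulr1 mul1r.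
by rewrite bop_scalerAr mulr1.
Qed.

(** The hypothesis says that [y] is fixed by the exponential of the small
    operator [S + i t]. *)
Lemma bop_exp_eigen_near0 S (t : R) y : opnorm S <= 4^-1 -> `|t| <= 4^-1 ->
  expi t *: bop_exp S y = y -> S y = (0 +i* (- t)) *: y.
Proof.
move=> S4 t4 Sy.
have : (S + (0 +i* t) *: (1 : bop V)) y = 0.
  apply: bop_exp_fixed_small; last by rewrite bop_expDimag.
  rewrite (le_trans (opnormD _ _))// opnormZ.
  have := modulus_le 0 t; rewrite normr0 add0r => t4'.
  have := ler_pM (modulus_ge0 (0 +i* t)) (opnorm_ge0 _) t4' (opnorm1_le V).
  lra.
rewrite bopD bopZ bop1 => /eqP; rewrite addr_eq0 => /eqP ->.
by rewrite -scaleNr; congr (_ *: _); simpc.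
Qed.

(** The number [1 - expi t] is bounded away from [0], while [e^S] is too close to
    the identity to have [expi (- t)] as an eigenvalue. *)
Lemma bop_exp_eigen_far S (d t : R) y : 0 <= d -> d <= t -> t <= pi *+ 2 - d ->
  opnorm S <= 2^-1 -> 2 * opnorm S < 1 - cos d ->
  expi t *: bop_exp S y = y -> y = 0.
Proof.
move=> d0 dt td S2 Sd Sy; apply/eqP; rewrite -normr_le0.
have E : (1 - expi t) *: y = expi t *: (bop_exp S y - y).
  by rewrite scalerBr Sy scalerBl scale1r.
have near0 : `|bop_exp S y - y| <= 2 * `|S y|.
  rewrite -[_ - y](subrK (S y)) (le_trans (ler_normD _ _))//.
  rewrite [leRHS](_ : _ = `|S y| + `|S y|) ?lerD2r; last by rewrite mulr_natl.
  rewrite (le_trans (bop_exp_small y S2))// ler_piMl//.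
  by rewrite invf_le1// ler1n.
have : (1 - cos d)%:C * `|y| <= (2 * opnorm S)%:C * `|y|.
  rewrite (@le_trans _ _ (`|expi t - 1| * `|y|))//.
    by rewrite ler_wpM2r// norm_expiB1.
  rewrite distrC -normrZ E normrZ normr_expi mul1r (le_trans near0)//.
  rewrite rmorphM (rmorph_nat (real_complex R)) -mulrA ler_wpM2l//.
  exact: opnormP.
rewrite -subr_le0 -mulrBl -rmorphB pmulr_rle0//.
by rewrite ltcR subr_gt0.
Qed.

Theorem bop_exp_fixed T x :
  (forall (k : int) y, k != 0 -> T y = (k%:~R * (0 +i* (2 * pi))) *: y -> y = 0) ->
  bop_exp T x = x -> T x = 0.
Proof.
(* Angles within [d] of [0] are near; [d] leaves room for [opnorm S <= 1 / 4]. *)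
move=> only0 Tx; pose d : R := 4^-1.
have d0 : 0 < d by rewrite invr_gt0.
have pi2 : 2 <= (pi : R) := pi_ge2 R.
have dpi : d <= pi by rewrite /d; lra.
have c0 : 0 < 1 - cos d by rewrite subr_gt0 cos_lt1.
have T0 := opnorm_ge0 T.
(* From [n > b] follow [opnorm S <= 1 / 4] and [2 * opnorm S < 1 - cos d]. *)
pose b := 4 * opnorm T + 2 * opnorm T / (1 - cos d) + 1.
have b0 : 0 <= b by rewrite /b !addr_ge0// ?mulr_ge0// invr_ge0 ltW.
pose n := Num.bound b; have nb : b < n%:R := archi_boundP b0.
have b1 : 0 < b by rewrite /b ltr_wpDl// !addr_ge0// ?mulr_ge0// invr_ge0 ltW.
have n0R : 0 < n%:R :> R := lt_trans b1 nb.
have n0 : (0 < n)%N by rewrite ltr0n in n0R.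
pose S : bop V := (n%:R^-1)%:C *: T.
have nS : T = S *+ n.
  rewrite -[_ *+ n](@scaler_nat R[i]) scalerA -(rmorph_nat (real_complex R)) -rmorphM.
  by rewrite divff ?scale1r// gt_eqF.
have oS : opnorm S = opnorm T / n%:R.
  have nV0 : 0 <= n%:R^-1 :> R by rewrite invr_ge0 ltW.
  by rewrite opnormZ (modulus_real nV0) mulrC.
have q0 : 0 <= 2 * opnorm T / (1 - cos d) by rewrite divr_ge0 ?mulr_ge0// ltW.
have S4 : opnorm S <= 4^-1.
  by rewrite oS ler_pdivrMr//; move: nb; rewrite /b; lra.
have Sc : 2 * opnorm S < 1 - cos d.
  rewrite oS mulrA ltr_pdivrMr// -ltr_pdivrMl// mulrC.
  by move: nb; rewrite /b; lra.
pose t : R := pi *+ 2 / n%:R.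
have tn : t * n%:R = pi *+ 2 by rewrite divfK// gt_eqF.
have eigenT (k : int) y : `|t * k%:~R| <= d -> k != 0 ->
    expi (t * k%:~R) *: bop_exp S y = y -> y = 0.
  move=> tk k0 /(bop_exp_eigen_near0 S4 tk) Sy.
  apply: (only0 (- k)); first by rewrite oppr_eq0.
  rewrite {1}nS -[S *+ n](@scaler_nat R[i]) bopZ Sy scalerA; congr (_ *: _).
  rewrite -(rmorph_nat (real_complex R) n) -(rmorph_int (real_complex R) (- k)).
  rewrite mulr_natl -tn rmorphN; simpc; congr (_ +i* _); ring.
have Sx : bop_exp S x = x.
  apply: (fixed_by_fourier (expi_prim_root n0)).
    by rewrite -bop_exp_mulrn -nS.
  move=> j /andP[j0 jn] y; rewrite -/t -expi_mulrn -mulr_natr.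
  have [tj|tj] := leP (t * j%:R) d.
    apply: (eigenT j%:Z); last by rewrite -lt0n.
    by rewrite ger0_norm// mulr_ge0// divr_ge0// mulrn_wge0// pi_ge0.
  have [tj'|tj'] := leP (t * j%:R) (pi *+ 2 - d).
    apply: bop_exp_eigen_far (ltW d0) (ltW tj) tj' _ Sc; lra.
  (* Removing a full turn makes an angle just below [2 pi] near [0]. *)
  rewrite -[t * _](subrK (pi *+ 2)) expiD2pi -tn -mulrBr.
  have -> : j%:R - n%:R = (j%:Z - n%:Z)%:~R :> R by rewrite rmorphB.
  apply: (eigenT (j%:Z - n%:Z)); last by rewrite subr_eq0 eqz_nat ltn_eqF.
  have tjn : t * j%:R <= t * n%:R.
    by rewrite ler_wpM2l ?ler_nat 1?ltnW// divr_ge0// mulrn_wge0// pi_ge0.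
  rewrite rmorphB /= mulrBr tn ler_norml; move: tjn; rewrite tn => tjn.
  apply/andP; split; lra.
have : S x = 0 by apply: bop_exp_fixed_small Sx; lra.
by rewrite nS => S0; rewrite -[_ *+ n](@scaler_nat R[i]) bopZ S0 scaler0.
Qed.

End FixedVectors.

(** * The commutator operator *)
Section Multiplications.
Context {R : realType} (X : completeNormedModType R[i]).
Implicit Types A B Y : bop X.

Lemma mull_bounded A : (fun Y => A * Y) \in @bounded_linear R (bop X).
Proof.
apply/bounded_linearP; split=> [a Y Z|]; first by rewrite mulrDr bop_scalerAr.
by exists (opnorm A) => Y; rewrite -bop_normE bop_normM.
Qed.
Definition bop_mull A : bop (bop X) := Bop (mull_bounded A).

Lemma mulr_bounded A : (fun Y => Y * A) \in @bounded_linear R (bop X).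
Proof.
apply/bounded_linearP; split=> [a Y Z|]; first by rewrite mulrDl bop_scalerAl.
by exists (opnorm A) => Y; rewrite -bop_normE mulrC bop_normM.
Qed.
Definition bop_mulr A : bop (bop X) := Bop (mulr_bounded A).

Lemma bop_sumE (V : normedModType R[i]) n (F : 'I_n -> bop V) (x : V) :
  (\sum_(i < n) F i) x = \sum_(i < n) F i x.
Proof. by elim/big_ind2 : _ => // f a g b <- <-. Qed.

Lemma bop_exp_mull A Y : bop_exp (bop_mull A) Y = bop_exp A * Y.
Proof.
have L := cvg_bop_apply (x := Y) (@exp_partial_cvg _ _ (bop_mull A)).
have YY : (cst Y : nat -> bop X) @ \oo --> Y by exact: cvg_cst.
have M := cvg_bopM (@exp_partial_cvg _ _ A) YY.
suff E : (fun n => exp_partial (bop_mull A) n Y) = (fun n => exp_partial A n * cst Y n).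
  by rewrite E in L; exact: (@cvg_unique _ (@norm_hausdorff _ (bop X)) _ _ _ _ L M).
have powE k : (bop_mull A ^+ k) Y = A ^+ k * Y.
  by elim: k => [|k IH]; rewrite ?mul1r// !exprS bopM IH /= mulrA.
apply/funext => n; rewrite !exp_partialE bop_sumE mulr_suml.
by apply: eq_bigr => k _; rewrite bopZ powE bop_scalerAl.
Qed.

Lemma bop_exp_mulr A Y : bop_exp (bop_mulr A) Y = Y * bop_exp A.
Proof.
have L := cvg_bop_apply (x := Y) (@exp_partial_cvg _ _ (bop_mulr A)).
have YY : (cst Y : nat -> bop X) @ \oo --> Y by exact: cvg_cst.
have M := cvg_bopM YY (@exp_partial_cvg _ _ A).
suff E : (fun n => exp_partial (bop_mulr A) n Y) = (fun n => cst Y n * exp_partial A n).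
  by rewrite E in L; exact: (@cvg_unique _ (@norm_hausdorff _ (bop X)) _ _ _ _ L M).
have powE k : (bop_mulr A ^+ k) Y = Y * A ^+ k.
  by elim: k => [|k IH]; rewrite ?mulr1// exprS exprSr bopM IH /= mulrA.
apply/funext => n; rewrite !exp_partialE bop_sumE mulr_sumr.
by apply: eq_bigr => k _; rewrite bopZ powE bop_scalerAr.
Qed.

(** By commutation of the two multiplications, [e^(L - Q) = e^(-Q) e^L], where
    [L] and [Q] are left and right multiplication by [A]; and [e^L] and [e^Q]
    agree on [B], because [e^A B = B e^A]. *)
Lemma bop_exp_commutator_fixed A B : bop_exp A * B = B * bop_exp A ->
  bop_exp (bop_mull A - bop_mulr A) B = B.
Proof.
move=> eAB; pose L := bop_mull A; pose Q := bop_mulr A.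
have QL : - Q * L = L * - Q.
  by rewrite mulrN mulNr; congr (- _); apply: bopP => Y; rewrite !bopM /= mulrA.
(* The ascribed types use the norm that [bop X] has by itself; the lemmas yield
     the convertible one that underlies its structure of complete space. *)
have eD : bop_exp (- Q + L) = bop_exp (- Q) * bop_exp L := @bop_expD _ _ _ _ QL.
have eN : bop_exp (- Q) * bop_exp Q = 1 := @bop_expN _ _ Q.
have eLQ : bop_exp L B = bop_exp Q B.
  exact: etrans (etrans (bop_exp_mull A B) eAB) (esym (bop_exp_mulr A B)).
by rewrite -/L -/Q addrC eD bopM eLQ -bopM eN.
Qed.

End Multiplications.

Theorem theorem2 (R : realType) (X : completeNormedModType R[i])
    (A B : bop X)
    (hA : congruence_free (0 +i* (2 * pi)) (bop_spectrum A)) :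
  bop_exp A * B = B * bop_exp A <-> A * B = B * A.
Proof.
split=> [/bop_exp_commutator_fixed fixed|/bop_exp_comm//].
have : (bop_mull A - bop_mulr A) B = 0.
  apply: bop_exp_fixed fixed => k Y k0; rewrite bopB /= => AY.
  apply: commutator_eigenvector_eq0 AY => z Az Azl.
  by have := hA z _ Az Azl k k0; rewrite opprB addrCA subrr addr0 eqxx.
by rewrite bopB /= => /eqP; rewrite subr_eq0 => /eqP.
Qed.
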